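(* Let $n\in\mathbb{Z}^+$ and let $\alpha=(a_1,\dots,a_n)$ be a unit interval parking function of length $n$. Then the number of lucky cars of $\alpha$ equals the number of blocks in the block structure of $\alpha$.
   Context: A parking preference $(a_1,\dots,a_n)\in[n]^n$ describes $n$ cars entering a one-way street with spots $1,\dots,n$ in the order $1,2,\dots,n$; car $i$ parks in the first unoccupied spot numbered $\ge a_i$. It is a parking function if all cars park. It is a unit interval parking function if it is a parking function and every car $i$ parks in spot $a_i$ or spot $a_i+1$. Car $i$ is lucky if it parks in spot $a_i$. Block structure: let $\alpha^{\uparrow}=(a_1',\dots,a_n')$ be the weakly increasing rearrangement of $\alpha$. The indices $i$ with $a_i'=i$ are the block starts; the block structure $\alpha'=\pi_1|\pi_2|\cdots|\pi_k$ cuts $\alpha^{\uparrow}$ into consecutive segments, each beginning at a block start and running up to just before the next block start (or to the end). The segments $\pi_1,\dots,\pi_k$ are the blocks. *)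

(* Defs.v *)
From mathcomp Require Import all_boot.

Set Implicit Arguments.
Unset Strict Implicit.
Unset Printing Implicit Defensive.

(* Spots and preferences are numbered 1..n.  Cars are indexed by 'I_n, so the
   ordinal i is the (i+1)-st car to enter. *)

Section Parking.

Variable n : nat.
Implicit Type a : n.-tuple nat.

Definition preference a : bool := all (fun p => 1 <= p <= n) a.

(* None means that every spot in p..n is taken, i.e. the car fails to park. *)
Definition first_free (occ : seq nat) (p : nat) : option nat :=
  ohead [seq s <- iota p (n.+1 - p) | s \notin occ].

Fixpoint park (occ : seq nat) (prefs : seq nat) : seq (option nat) :=
  if prefs is p :: prefs' then
    let o := first_free occ p in
    o :: park (if o is Some s then s :: occ else occ) prefs'
  else [::].

Definition spot a (i : 'I_n) : option nat := nth None (park [::] a) i.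

Definition parking_function a : bool :=
  preference a && [forall i, isSome (spot a i)].

Definition lucky a (i : 'I_n) : bool := spot a i == Some (tnth a i).

Definition unit_interval_parking_function a : bool :=
  parking_function a &&
  [forall i, (spot a i == Some (tnth a i)) ||
             (spot a i == Some (tnth a i).+1)].

(* The i-th entry, counting from i = 1, of the weakly increasing
   rearrangement. *)
Definition rearr a (i : nat) : nat := nth 0 (sort leq a) i.-1.

Definition block_starts a : seq nat := [seq i <- iota 1 n | rearr a i == i].

(* Each block start i is paired with the next block start j (with n.+1 for the
   last one); the block is then the segment at positions i, ..., j - 1. *)
Definition block_structure a : seq (seq nat) :=
  [seq [seq rearr a m | m <- iota ij.1 (ij.2 - ij.1)]
     | ij <- zip (block_starts a) (rcons (behead (block_starts a)) n.+1)].

End Parking.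

(* Main.v *)
Require Import Defs.
From mathcomp Require Import all_boot.
From mathcomp Require Import zify.

(** The cars occupy the spots [1..n] bijectively.  Since every car prefers its
spot or the one just before, the cars preferring a spot [<= k] are those parked
in [1..k], together with the car in spot [k + 1] when it is unlucky.  Hence the
entry at position [k + 1] of the sorted list is at most [k + 1], and it equals
[k + 1] exactly when the car in spot [k + 1] is lucky: the lucky spots are the
block starts. *)

Lemma first_freeP (n : nat) (occ : seq nat) (p s : nat) :
  first_free n occ p = Some s -> [/\ p <= s, s <= n & s \notin occ].
Proof.
rewrite /first_free => e.
have: s \in [seq s <- iota p (n.+1 - p) | s \notin occ].
  by move: e; case: [seq _ <- _ | _] => //= x l [->]; rewrite inE eqxx.
rewrite mem_filter mem_iota => /and3P[-> leps lts]; split=> //; lia.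
Qed.

Lemma size_park (n : nat) (occ prefs : seq nat) :
  size (park n occ prefs) = size prefs.
Proof. by elim: prefs occ => //= p l IH occ; rewrite IH. Qed.

Lemma nth_park_bounds (n : nat) (occ prefs : seq nat) (i s : nat) :
  nth None (park n occ prefs) i = Some s -> nth 0 prefs i <= s <= n.
Proof.
elim: prefs occ i => [|p l IH] occ [|i] //=; last by move/IH.
by case/first_freeP=> -> ->.
Qed.

Lemma park_notin_occ (n : nat) (occ prefs : seq nat) (s : nat) :
  Some s \in park n occ prefs -> s \notin occ.
Proof.
elim: prefs occ => [|p l IH] occ //=; rewrite inE.
case/orP=> [/eqP/esym/first_freeP[] //|/IH].
by case: first_free => // t; rewrite inE negb_or => /andP[].
Qed.

(** A spot joins [occ] once taken, so no later car gets it. Cars that fail to park must be excluded,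
    as [None] could repeat. *)
Lemma park_uniq (n : nat) (occ prefs : seq nat) :
  all isSome (park n occ prefs) -> uniq (park n occ prefs).
Proof.
elim: prefs occ => [|p l IH] occ //=.
case: first_free => //= s /IH ->; rewrite andbT.
by apply/negP => /park_notin_occ; rewrite inE eqxx.
Qed.

(** In a sorted list the entries at most [j] form a prefix. This turns bounds on the rearrangement
    into counts of cars. *)
Lemma nth_sorted_leq (s : seq nat) (i j : nat) :
  sorted leq s -> i < size s ->
  (nth 0 s i <= j) = (i < count (fun x => x <= j) s).
Proof.
elim: s i => [|x s IH] i //= srt lti; have [lexj|ltjx] := leqP x j.
  by case: i lti => [|i] //= lti; rewrite add1n ltnS -IH // (path_sorted srt).
have gtj : all (fun y => j < y) (x :: s).
  rewrite /= ltjx; apply: sub_all (order_path_min leq_trans srt) => y.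
  exact: leq_trans.
rewrite leqNgt (allP gtj) ?(mem_nth 0 (s := x :: s)) //=.
suff /eqP-> : count (fun y => y <= j) s == 0 by [].
rewrite -leqn0 leqNgt -has_count -all_predC.
by case/andP: gtj => _; apply: sub_all => y /=; rewrite ltnNge.
Qed.

Lemma card_set_count (T : finType) (P : pred T) :
  #|[set x | P x]| = count P (enum T).
Proof. by rewrite cardsE cardE enumT -size_filter. Qed.

Lemma count_tuple (T : Type) (n : nat) (P : pred T) (a : n.-tuple T) :
  count P a = #|[set i | P (tnth a i)]|.
Proof. by rewrite -[in LHS](map_tnth_enum a) count_map card_set_count. Qed.

Lemma card_ord_ltn (n k : nat) : k <= n -> #|[set i : 'I_n | i < k]| = k.
Proof.
by move=> lekn; rewrite -sum1dep_card (big_ord_narrow lekn) sum1_card card_ord.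
Qed.

Lemma size_block_structure (n : nat) (a : n.-tuple nat) :
  size (block_structure a) = #|[set k : 'I_n | rearr a k.+1 == k.+1]|.
Proof.
rewrite size_map size_zip size_rcons size_behead.
(* The list of next starts has size [m.-1.+1], which exceeds [m] when [m = 0]; [zip] truncates
   it. *)
have -> (m : nat) : minn m m.-1.+1 = m by lia.
rewrite size_filter (iotaDl 1 0) count_map -val_enum_ord count_map.
by rewrite card_set_count.
Qed.

Theorem theorem3p2 (n : nat) (a : n.-tuple nat) :
  0 < n ->
  unit_interval_parking_function a ->
  #|[set i : 'I_n | lucky a i]| = size (block_structure a).
Proof.
move=> _ /andP[/andP[/allP pref /forallP parks] /forallP unit_int].
(* [f i] is the spot of car [i] counted from 0. The defaults of [odflt] and [insubd] are never
   reached, since every car parks in [1..n]. *)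
pose f i : 'I_n := insubd i (odflt 0 (spot a i)).-1.
have spotE i : spot a i = Some (f i).+1.
  case e: (spot a i) (parks i) => [s|] // _.
  have /andP[les sn] := nth_park_bounds _ _ _ _ _ e.
  have /andP[p1 _] := pref _ (mem_tnth i a).
  rewrite (tnth_nth 0) in p1.
  congr Some; rewrite /f e val_insubd /=; case: ifP; lia.
have inj_f : injective f.
  move=> i j efij; apply/val_inj/eqP.
  rewrite -(nth_uniq None (s := park n [::] a)) ?size_park ?size_tuple ?ltn_ord //.
    by rewrite -!/(spot a _) !spotE efij.
  apply: park_uniq; apply/(all_nthP None) => k; rewrite size_park size_tuple.
  by move=> ltk; exact: parks (Ordinal ltk).
have luckyE i : lucky a i = ((f i).+1 == tnth a i).
  by rewrite /lucky spotE.
(* Because [f] counts from 0, a lucky car prefers [f i + 1] and an unlucky one [f i]. *)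
have unitE i : tnth a i = f i + lucky a i.
  by move: (unit_int i); rewrite luckyE spotE => /orP[]/eqP[]; case: eqP; lia.
have card_f k : k <= n -> #|[set i | f i < k]| = k.
  move=> lekn; rewrite -[RHS](card_ord_ltn _ _ lekn) -(card_imset _ inj_f).
  by apply: eq_card => x; rewrite -(f_invF inj_f x) mem_imset // !inE.
(* Move the lucky cars to their spots along [f], then compare the two sets spot by spot, writing
   each spot as [f i]. *)
rewrite size_block_structure -(card_imset _ inj_f).
apply: eq_card => k; rewrite -(f_invF inj_f k) mem_imset // !inE.
move: (invF inj_f k) => {k} i.
have lei j : (nth 0 (sort leq a) (f i) <= j)
             = (f i < #|[set x | tnth a x <= j]|).
  rewrite nth_sorted_leq ?(sort_sorted leq_total) ?size_sort ?size_tuple //.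
  by rewrite (permP (permEl (perm_sort leq a))) count_tuple.
have le_fi1 : rearr a (f i).+1 <= (f i).+1.
  (* The [f i + 1] cars parked no further than car [i] all prefer at most [f i + 1]. *)
  rewrite /rearr lei -[X in X <= _](card_f (f i).+1) //.
  by apply/subset_leq_card/subsetP => x; rewrite !inE unitE; lia.
have le_fi : (rearr a (f i).+1 <= f i) = ~~ lucky a i.
  rewrite /rearr lei /=; have cf := card_f _ (ltnW (ltn_ord (f i))).
  case Li: (lucky a i) => /=.
    (* A car preferring at most [f i] parks no further than car [i], and is not car [i], which
       prefers [f i + 1]; only [f i] cars remain. *)
    rewrite -[X in X < _]cf ltnNge; apply/negbF/subset_leq_card/subsetP => x.
    rewrite !inE unitE; case: (eqVneq x i) => [->|]; first by rewrite Li; lia.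
    by move/(contra_neq (@inj_f _ _)); rewrite -val_eqE /=; lia.
  (* The [f i] cars parked before car [i] prefer at most [f i], and so does the unlucky car [i]
     itself. *)
  rewrite -[X in X < _]cf; apply: proper_card; apply/properP; split.
    by apply/subsetP => x; rewrite !inE unitE; lia.
  by exists i; rewrite !inE ?unitE ?Li; lia.
by rewrite eqn_leq le_fi1 /= ltnNge le_fi negbK.
Qed.
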